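(* Let $(X,d)$ be a nonempty compact metric space, let $m\ge1$, let $f_0,\dots,f_{m-1}:X\to X$ be continuous maps and let $G=\{f_0,\dots,f_{m-1}\}$ be the free semigroup action they generate. Let $\bar b$ be the upper box dimension of $X$. There exists a constant $C>0$ such that for all small enough $\varepsilon>0$: (1) if $G$ is chain transitive, then $r_\varepsilon(G)\le C/\varepsilon^{\bar b+1}$; (2) if $G$ is chain mixing, then $m_\varepsilon(\delta,G)\le C/\varepsilon^{2(\bar b+1)}$ (for $\delta>\varepsilon$).
   Context: $F_m^+$ is the set of nonempty finite words in the symbols $0,\dots,m-1$; $|w|$ is the length of $w$. For $w=i_0\cdots i_{n-1}\in F_m^+$ and $\varepsilon>0$, a $(w,\varepsilon)$-chain of $G$ from $x$ to $y$ is a sequence $(x_0=x,x_1,\dots,x_n=y)$ in $X$ with $d(f_{i_j}(x_j),x_{j+1})\le\varepsilon$ for $j=0,\dots,n-1$; its length is $n=|w|$. $G$ is chain transitive if for every $\varepsilon>0$ and all $x,y\in X$ there is a $(w,\varepsilon)$-chain from $x$ to $y$ for some $w\in F_m^+$. $G$ is chain mixing if for every $\varepsilon>0$ there is $N>0$ such that for all $x,y\in X$ and all $n\ge N$ there is a $(w,\varepsilon)$-chain from $x$ to $y$ for some $w\in F_m^+$ with $|w|=n$. Chain recurrence time: when, for every $\varepsilon>0$ and every $x\in X$, there is a $(w,\varepsilon)$-chain from $x$ to itself for some $w$ (in particular when $G$ is chain transitive), $r_\varepsilon(x,G)$ is the smallest $n$ such that there is a $(w,\varepsilon)$-chain from $x$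 to itself with $|w|=n$, and $r_\varepsilon(G)=\max_{x\in X}r_\varepsilon(x,G)$. Chain mixing time: if $G$ is chain mixing, $0<\varepsilon<\delta$ and $x\in X$, $m_\varepsilon(x,\delta,G)$ is the smallest positive integer $N$ such that for every $n\ge N$ and every $y\in X$ there is a $(w,\varepsilon)$-chain from some point of the ball $B(x,\delta)$ to $y$ for some $w\in F_m^+$ with $|w|=n$; $m_\varepsilon(\delta,G)=\max_{x\in X}m_\varepsilon(x,\delta,G)$. Upper box dimension: $\bar b=\limsup_{\rho\to0}\frac{\log N_\rho(X)}{-\log\rho}$, where $N_\rho(X)$ is the smallest number of sets of diameter at most $\rho$ covering $X$. *)

(* Defs.v *)
From HB Require Import structures.
From mathcomp Require Import all_boot all_order all_algebra.
From mathcomp Require Import all_classical all_reals all_analysis.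

Set Implicit Arguments.
Unset Strict Implicit.
Unset Printing Implicit Defensive.

Import Order.TTheory GRing.Theory Num.Theory.
Import numFieldNormedType.Exports.

Local Open Scope classical_set_scope.
Local Open Scope ring_scope.

(* The smallest element of P as an extended real; +oo if P is empty. *)
Definition least (R : realType) (P : set nat) : \bar R :=
  ereal_inf [set (n%:R)%:E | n in P].

(* a ^ s = exp (s * ln a) with an extended real exponent, for 0 < a;
   for a < 1 this gives a ^ +oo = 0, whose ereal inverse is +oo. *)
Definition epow (R : realType) (a : R) (s : \bar R) : \bar R :=
  expeR (s * (ln a)%:E)%E.

Section Dimension.
Variables (R : realType) (X : metricType R).

Definition diameter (A : set X) : \bar R :=
  ereal_sup [set (mdist p.1 p.2)%:E | p in A `*` A].

Definition covering_number (rho : R) : \bar R :=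
  least R [set n | exists A : 'I_n -> set X,
    (forall i, (diameter (A i) <= rho%:E)%E) /\
    \bigcup_(i in [set: 'I_n]) A i = [set: X]].

Definition upper_box_dim : \bar R :=
  limf_esup (fun rho : R => lne (covering_number rho) / (- ln rho)%:E)%E 0^'+.

End Dimension.

Section Chains.
Variables (R : realType) (X : metricType R) (m : nat) (f : 'I_m -> X -> X).

Definition words : set (seq 'I_m) := [set w | w != [::]].

(* Only the values s 0, ..., s (size w) of s matter. *)
Definition chain (w : seq 'I_m) (eps : R) (x y : X) : Prop :=
  exists s : nat -> X, [/\ s 0%N = x, s (size w) = y &
    forall j : 'I_(size w),
      mdist (f (tnth (in_tuple w) j) (s j)) (s j.+1) <= eps].

Definition chain_of_length (eps : R) (n : nat) (x y : X) : Prop :=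
  exists w, [/\ words w, size w = n & chain w eps x y].

Definition chain_transitive : Prop :=
  forall eps : R, 0 < eps -> forall x y : X,
    exists2 w, words w & chain w eps x y.

Definition chain_mixing : Prop :=
  forall eps : R, 0 < eps -> exists2 N : nat, (0 < N)%N &
    forall (x y : X) (n : nat), (N <= n)%N -> chain_of_length eps n x y.

Definition chain_rec_time_at (eps : R) (x : X) : \bar R :=
  least R [set n | chain_of_length eps n x x].

(* The values lie in nat or are +oo, so the supremum is a maximum as soon as it
   is finite; the same holds for chain_mix_time. *)
Definition chain_rec_time (eps : R) : \bar R :=
  ereal_sup [set chain_rec_time_at eps x | x in [set: X]].

Definition chain_mix_time_at (eps : R) (x : X) (delta : R) : \bar R :=
  least R [set N | (0 < N)%N /\ forall (n : nat) (y : X), (N <= n)%N ->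
    exists2 z, ball x delta z & chain_of_length eps n z y].

Definition chain_mix_time (eps delta : R) : \bar R :=
  ereal_sup [set chain_mix_time_at eps x delta | x in [set: X]].

End Chains.

(* Main.v *)
(* Cover [X] by [N] cells of diameter at most [eps / 2] and draw an edge between
   two cells when some [f i] maps a point of the first to within [eps / 2] of a
   point of the second.  [eps / 2]-chains project to walks in this graph, and
   walks lift to [eps]-chains.  Chain transitivity thus gives return walks, which
   shorten to length at most [N]; chain mixing makes the graph primitive, so that
   any two cells are joined by walks of every length at least [N ^ 2 - 1].
   Finally [N <= (eps / 2) ^ - (b + 1)] for small [eps], because the upper box
   dimension [b] is less than [b + 1] when finite. *)
Require Import Defs.
From HB Require Import structures.
From mathcomp Require Import all_boot all_order all_algebra.
From mathcomp Require Import all_classical all_reals all_analysis.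
From mathcomp Require Import zify lra.
Set Implicit Arguments.
Unset Strict Implicit.
Unset Printing Implicit Defensive.

Import Order.TTheory GRing.Theory Num.Theory.
Import numFieldNormedType.Exports.
Local Open Scope classical_set_scope.
Local Open Scope ring_scope.

(** * Walks of prescribed length in a finite directed graph *)

Fixpoint walk {T : finType} (e : rel T) (n : nat) : rel T :=
  if n is n'.+1 then fun a b => [exists c, e a c && walk e n' c b]
  else fun a b => a == b.

Section Walks.
Variable T : finType.
Implicit Types (e : rel T) (a b c : T).

Lemma walkS e n a b c : e a b -> walk e n b c -> walk e n.+1 a c.
Proof. by move=> ab bc; apply/existsP; exists b; rewrite ab. Qed.

Lemma walk_cat e m n a b c :
  walk e m a b -> walk e n b c -> walk e (m + n) a c.
Proof.
elim: m a => [|m IH] a; first by move=> /eqP ->.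
by move=> /existsP[a' /andP[aa' a'b]] bc; apply: (@walkS e _ _ a') => //; apply: IH.
Qed.

Lemma walk_connect e n a b : walk e n a b -> connect e a b.
Proof.
elim: n a => [|n IH] a; first by move=> /eqP ->; exact: connect0.
by move=> /existsP[c /andP[ac /IH]]; apply: connect_trans; exact: connect1.
Qed.

(** A repetition-free path visits at most [#|T|] vertices, hence has fewer than [#|T|] edges. *)
Lemma connect_walk e a b :
  connect e a b -> exists2 n, (n < #|T|)%N & walk e n a b.
Proof.
move=> /connectP[p0 /shortenP[p e_p Up _] ->]; exists (size p).
  by rewrite -[_.+1]/(size (a :: p)) -(card_uniqP Up) max_card.
elim: p a {p0 Up} e_p => [|c p IH] a //= /andP[ac /IH cp].
by apply/existsP; exists c; rewrite ac.
Qed.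

(** Since [walk e s] is again a relation, it serves as the edge relation of the [s]-th power of the
    graph. The inner induction splits off the first [s] steps. *)
Lemma walk_mul e s n a b : walk e (n * s) a b -> walk (walk e s) n a b.
Proof.
elim: n a => [|n IH] a //; rewrite mulSn => ab.
suff [c ac cb] : exists2 c, walk e s a c & walk e (n * s) c b.
  by apply: (@walkS _ _ _ c) => //; apply: IH.
elim: s a (n * s)%N ab {IH} => [|s IH] a k; first by exists a => //=.
rewrite addSn => /existsP[c /andP[ac /IH[c' cc' c'b]]].
by exists c' => //; apply: (@walkS _ _ _ c).
Qed.

Lemma mul_walk e s n a b : walk (walk e s) n a b -> walk e (n * s) a b.
Proof.
elim: n a => [|n IH] a //; rewrite mulSn => /existsP[c /andP[ac /IH]].
exact: walk_cat.
Qed.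

Lemma walk_loop e n k a b :
  e a a -> walk e k a b -> (k <= n)%N -> walk e n a b.
Proof.
move=> aa ab /subnK <-; elim: (n - k)%N => [|j IH] //.
by rewrite addSn; apply: (@walkS _ _ _ a).
Qed.

(** Moving the base point one step along the closed walk rotates it without changing its length. *)
Lemma walk_cycle e s t a : walk e s.+1 a a ->
  exists2 b, walk e t a b & walk e s.+1 b b.
Proof.
elim: t a => [|t IH] a; first by exists a => //=.
move=> /existsP[c /andP[ac ca]].
have /IH[b cb bb] : walk e s.+1 c c.
  by rewrite -addn1; apply: (@walk_cat _ _ _ _ a) => //; apply: (@walkS _ _ _ c) => //=.
by exists b => //; apply: (@walkS _ _ _ c).
Qed.

(* A shortest cycle has length [s <= #|T|].  In the graph of [s]-step walks its
   vertices carry loops, so from them every vertex is reached in exactly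
   [#|T| - 1] steps of length [s]; the cycle absorbs any excess length. *)
Lemma primitive_walk e n0 :
  (forall a b n, (n0 <= n)%N -> walk e n a b) ->
  forall a b n, (#|T| ^ 2 <= n.+1)%N -> walk e n a b.
Proof.
move=> mix a b n n_ge.
have [s s_lt bb] : exists2 s, (s < #|T|)%N & walk e s.+1 b b.
  have /existsP[c /andP[bc /walk_connect/connect_walk[s s_lt cb]]] :=
    mix b b n0.+1 (leqnSn _).
  by exists s => //; apply: (@walkS _ _ _ c).
have /connect_walk[k k_lt ab] := walk_connect (mix a b _ (leqnn _)).
have [c bc cc] := walk_cycle (n - (#|T|.-1 * s.+1 + k))%N bb.
(* Mixing supplies a walk of length [n0 * s.+1], which is at least [n0]; it is regrouped into blocks
   of [s.+1] steps. *)
have /connect_walk[j j_lt cb] : connect (walk e s.+1) c b.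
  by apply: (@walk_connect _ n0); apply: walk_mul; apply: mix; rewrite leq_pmulr.
have /mul_walk cb' : walk (walk e s.+1) #|T|.-1 c b.
  by apply: walk_loop cb _ => //; lia.
(* The subtraction is not truncated: [s < #|T|] and [k < #|T|] bound the subtracted length by
   [#|T| ^ 2 - 1], hence by [n]. *)
have -> : n = (k + ((n - (#|T|.-1 * s.+1 + k)) + #|T|.-1 * s.+1))%N.
  by have : (#|T|.-1 * s.+1 <= #|T|.-1 * #|T|)%N; [rewrite leq_mul2l s_lt orbT | nia].
by apply: walk_cat ab _; apply: walk_cat bc _.
Qed.

End Walks.

Lemma least_le (R : realType) (P : set nat) n : P n -> (least R P <= n%:R%:E)%E.
Proof. by move=> Pn; apply: ereal_inf_lbound; exists n. Qed.

(** * Covering numbers, box dimension and cells *)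

Section Covering.
Variables (R : realType) (X : metricType R).

Lemma covering_number_ge1 (rho : R) :
  [set: X] !=set0 -> (1 <= covering_number X rho)%E.
Proof.
case=> x _; apply: le_ereal_inf_tmp => _ [[|n] [A [_ A_cover]] <-].
  by have : [set: X] x by []; rewrite -A_cover => -[[]].
by rewrite lee_fin ler1n.
Qed.

(** For [rho < 1] both [lne] of the covering number and [- ln rho] are nonnegative. This excludes
    dimension [-oo]. *)
Lemma upper_box_dim_ge0 : [set: X] !=set0 -> (0 <= upper_box_dim X)%E.
Proof.
move=> X0; apply: le_ereal_inf_tmp => _ [V V_near <-].
have [rho [Vrho /andP[rho0 rho1]]] : exists rho, V rho /\ 0 < rho < (1 : R).
  apply: (@filter_ex _ (0 : R)^'+); near=> rho; split.
    by near: rho.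
  by apply/andP; split; [near: rho; exact: nbhs_right_gt |
    near: rho; exact: nbhs_right_lt].
apply: le_trans (ereal_sup_ubound (ex_intro2 _ _ rho Vrho erefl)).
apply: mule_ge0; first by rewrite lne_ge0; exact: covering_number_ge1.
by rewrite inve_ge0 lee_fin oppr_ge0 ln_le0 // ltW.
Unshelve. all: by end_near. Qed.

Lemma near_half (P : set R) :
  (\forall rho \near (0 : R)^'+, P rho) ->
  \forall eps \near (0 : R)^'+, P (eps / 2).
Proof.
move=> /nbhs_ballP[d /= d0 dP]; near=> eps.
have eps0 : 0 < eps by near: eps; exact: nbhs_right_gt.
have epsd : eps < d by near: eps; exact: nbhs_right_lt.
apply: dP; last by rewrite divr_gt0.
by rewrite /ball /= sub0r normrN gtr0_norm ?divr_gt0 //; lra.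
Unshelve. all: by end_near. Qed.

(** The last bound is [rho ^ - s]: near 0 the quotient defining the dimension stays below [s], and
    one multiplies by [- ln rho > 0] and exponentiates. *)
Lemma covering_bound (s : R) : [set: X] !=set0 -> (upper_box_dim X < s%:E)%E ->
  \forall rho \near (0 : R)^'+, exists n (A : 'I_n -> set X),
    [/\ forall i, (diameter (A i) <= rho%:E)%E,
        \bigcup_(i in [set: 'I_n]) A i = [set: X] &
        n%:R <= expR (- s * ln rho)].
Proof.
move=> X0 /ereal_inf_lt[_ [V V_near <-] V_lt]; near=> rho.
have rho0 : 0 < rho by near: rho; exact: nbhs_right_gt.
have rho1 : rho < 1 by near: rho; exact: nbhs_right_lt.
have L0 : 0 < - ln rho by rewrite oppr_gt0 ln_lt0 // rho0.
have Vrho : V rho by near: rho.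
have := le_lt_trans (ereal_sup_ubound (ex_intro2 _ _ rho Vrho erefl)) V_lt.
rewrite inver gt_eqF // lte_pdivrMr // -EFinM -lte_expeR lneK; last first.
  rewrite in_itv /= leey andbT.
  by apply: le_trans (covering_number_ge1 rho X0); rewrite lee_fin.
(* An infimum strictly below the bound yields an actual cover below it. *)
move=> /ereal_inf_lt[_ [n [A [A_diam A_cover]] <-]].
rewrite lte_fin => /ltW n_le; exists n, A; split => //.
by rewrite mulNr -mulrN.
Unshelve. all: by end_near. Qed.

Lemma mdist_le_diameter (A : set X) (rho : R) x y :
  (diameter A <= rho%:E)%E -> A x -> A y -> mdist x y <= rho.
Proof.
move=> A_diam Ax Ay; rewrite -lee_fin; apply: le_trans A_diam.
by apply: ereal_sup_ubound; exists (x, y).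
Qed.

(* Empty members of the cover are discarded, so that [c] is onto. *)
Lemma cover_cells (rho : R) n (A : 'I_n -> set X) :
  (forall i, (diameter (A i) <= rho%:E)%E) ->
  \bigcup_(i in [set: 'I_n]) A i = [set: X] ->
  exists (T : finType) (c : X -> T),
    [/\ (#|T| <= n)%N, forall a, exists x, c x = a &
        forall x y, c x = c y -> mdist x y <= rho].
Proof.
move=> A_diam A_cover.
have /choice[i0 Ai0] x : exists i, A i x.
  by have : [set: X] x by []; rewrite -A_cover => -[i _ Ai]; exists i.
pose hit i := `[< exists x, i0 x = i >].
have hit_i0 x : hit (i0 x) by apply/asboolP; exists x.
exists {i | hit i}, (fun x => Sub (i0 x) (hit_i0 x)); split.
- by rewrite card_sig -[leqRHS]card_ord max_card.
- by move=> [i hi]; have /asboolP[x xi] := hi; exists x; apply: val_inj.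
move=> x y /(congr1 val) /= ixy.
by apply: mdist_le_diameter (A_diam (i0 x)) _ _ => //; rewrite ixy.
Qed.

End Covering.

(** * Passage between chains and walks on cells *)

Section Cells.
Variables (R : realType) (X : metricType R) (m : nat) (f : 'I_m -> X -> X).

Lemma chain_nil (eps : R) x y : chain f [::] eps x y -> x = y.
Proof. by case=> s [<- <-]. Qed.

Lemma chain_consP (i : 'I_m) w (eps : R) x y : chain f (i :: w) eps x y <->
  exists2 z, mdist (f i x) z <= eps & chain f w eps z y.
Proof.
split=> [[s [<- <- s_eps]]|[z xz [s [sz <- s_eps]]]].
  exists (s 1%N); first exact: (s_eps ord0).
  exists (fun j => s j.+1); split=> // j.
  have := s_eps (lift ord0 j).
  by rewrite !(tnth_nth i).
exists (fun j => if j is j'.+1 then s j' else x); split=> //= -[[|j] j_lt].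
  by rewrite (tnth_nth i) /= sz.
have := s_eps (Ordinal (j_lt : (j < size w)%N)).
by rewrite !(tnth_nth i).
Qed.

Lemma chain_of_length1 (eps : R) i x y :
  mdist (f i x) y <= eps -> chain_of_length f eps 1 x y.
Proof.
move=> xy; exists [:: i]; split=> //; apply/chain_consP; exists y => //.
by exists (fun=> y); split=> // -[].
Qed.

Lemma chain_of_lengthS (eps : R) i n x y z : mdist (f i x) z <= eps ->
  chain_of_length f eps n z y -> chain_of_length f eps n.+1 x y.
Proof.
move=> xz [w [_ <- w_chain]]; exists (i :: w); split=> //.
by apply/chain_consP; exists z.
Qed.

Variables (T : finType) (c : X -> T) (eps : R).
Hypothesis c_diam : forall x y, c x = c y -> mdist x y <= eps / 2.
Hypothesis c_surj : forall a, exists x, c x = a.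

Definition cell_edge : rel T := fun a b =>
  `[< exists x y i, [/\ c x = a, c y = b & mdist (f i x) y <= eps / 2] >].

Lemma chain_cell_walk w x y :
  chain f w (eps / 2) x y -> walk cell_edge (size w) (c x) (c y).
Proof.
elim: w x => [|i w IH] x; first by move=> /chain_nil -> /=.
move=> /chain_consP[z xz /IH]; apply: walkS.
by apply/asboolP; exists x, z, i.
Qed.

(* The cell graph forgets where in a cell an edge ends, so the error [eps / 2]
   of an edge is increased by the diameter of that cell. *)
Lemma cell_walk_chain n i x y z : mdist (f i x) z <= eps / 2 ->
  walk cell_edge n (c z) (c y) -> chain_of_length f eps n.+1 x y.
Proof.
have jump j p q r : mdist (f j p) q <= eps / 2 -> c q = c r ->
    mdist (f j p) r <= eps.
  move=> pq /c_diam qr; apply: le_trans (metric_triangle _ q _) _.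
  by rewrite [leRHS]splitr lerD.
elim: n i x z => [|n IH] i x z xz.
  by move=> /eqP zy; apply: (@chain_of_length1 _ i); apply: jump xz zy.
move=> /existsP[b /andP[/asboolP[p [q [j [pz <- pq]]]] qy]].
apply: (@chain_of_lengthS _ i _ _ _ p); first by apply: jump xz _.
exact: IH pq qy.
Qed.

Lemma chain_rec_time_le : 0 < eps -> chain_transitive f ->
  (chain_rec_time f eps <= #|T|%:R%:E)%E.
Proof.
move=> eps0 trans; apply: ge_ereal_sup => _ [x _ <-].
have eps2 : 0 < eps / 2 by rewrite divr_gt0.
(* The first step is kept, as a cell edge need not start at [x] itself. Only the rest is shortened,
   to fewer than [#|T|] steps. *)
have [[|i w] // _ /chain_consP[z xz zx]] := trans _ eps2 x x.
have /connect_walk[n n_lt n_walk] := walk_connect (chain_cell_walk zx).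
apply: (@le_trans _ _ n.+1%:R%:E); last by rewrite lee_fin ler_nat.
by apply: least_le; apply: cell_walk_chain xz n_walk.
Qed.

Lemma chain_mix_time_le (delta : R) : (0 < m)%N -> 0 < eps -> eps < delta ->
  chain_mixing f -> (chain_mix_time f eps delta <= (#|T| ^ 2)%:R%:E)%E.
Proof.
move=> m0 eps0 eps_delta mix; apply: ge_ereal_sup => _ [x _ <-].
have eps2 : 0 < eps / 2 by rewrite divr_gt0.
have [n0 _ n0_mix] := mix _ eps2.
apply: least_le; split.
  by rewrite expn_gt0; apply/orP; left; apply/card_gt0P; exists (c x).
move=> n y n_ge; exists x.
  by rewrite ballEmdist /= mdistxx (lt_trans eps0).
have n_gt0 : (0 < n)%N.
  by apply: leq_trans n_ge; rewrite expn_gt0; apply/orP; left; apply/card_gt0P; exists (c x).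
(* An exact first step to [f i x] leaves [n.-1] steps, which matches the bound on [n.+1] in
   [primitive_walk]. *)
pose i := Ordinal m0; rewrite -(prednK n_gt0).
apply: (@cell_walk_chain _ i _ _ (f i x)).
  by rewrite mdistxx ltW.
apply: (@primitive_walk _ _ n0); last by rewrite prednK.
move=> a b k k_ge; have [p <-] := c_surj a; have [q <-] := c_surj b.
by have [w [_ <- w_chain]] := n0_mix p q _ k_ge; apply: chain_cell_walk.
Qed.

End Cells.

Unset Implicit Arguments.

Theorem theorem1p2 (R : realType) (X : metricType R) (m : nat)
    (f : 'I_m -> X -> X) (X_nonempty : [set: X] !=set0)
    (X_compact : compact [set: X]) (m_ge1 : (1 <= m)%N)
    (f_continuous : forall i, continuous (f i)) :
  exists2 C : R, 0 < C &
    \forall eps \near (0 : R)^'+,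
      (chain_transitive f ->
        (chain_rec_time f eps <=
           C%:E / epow eps (upper_box_dim X + 1))%E) /\
      (chain_mixing f -> forall delta : R, eps < delta ->
        (chain_mix_time f eps delta <=
           C%:E / epow eps (2%:E * (upper_box_dim X + 1)))%E).
Proof.
have b_ge0 := upper_box_dim_ge0 X_nonempty.
case b_eq : (upper_box_dim X) b_ge0 => [r| |] //; last first.
  (* In infinite dimension [eps < 1] makes both denominators 0, so both bounds are [+oo]. *)
  move=> _; exists 1 => //; near=> eps.
  have eps_lt1 : 0 < eps < 1.
    by apply/andP; split; [near: eps; exact: nbhs_right_gt |
      near: eps; exact: nbhs_right_lt].
  have top : (1%:E / epow eps +oo = +oo)%E.
    by rewrite /epow lt0_mulye ?lte_fin ?ln_lt0 //= inve0 mul1e.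
  by split=> *; rewrite addye ?gt0_muley ?lte_fin // top leey.
rewrite lee_fin => r_ge0.
have : (upper_box_dim X < (r + 1)%:E)%E by rewrite b_eq lte_fin ltrDl.
move=> /(covering_bound X_nonempty)/near_half bound.
(* The constant is [2 ^ (2 (r + 1))]: cells of size [eps / 2] cost a factor [2 ^ (r + 1)], which is
   squared for the mixing time. *)
exists (expR (2 * (r + 1) * ln 2)); first exact: expR_gt0.
near=> eps.
have eps0 : 0 < eps by near: eps; exact: nbhs_right_gt.
have [n [A [A_diam A_cover n_le]]] : exists n (A : 'I_n -> set X),
    [/\ forall i, (diameter (A i) <= (eps / 2)%:E)%E,
        \bigcup_(i in [set: 'I_n]) A i = [set: X] &
        n%:R <= expR (- (r + 1) * ln (eps / 2))].
  by near: eps.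
have [T [c [T_le c_surj c_diam]]] := cover_cells A_diam A_cover.
have epowE s : epow eps s%:E = (expR (s * ln eps))%:E by [].
have T_le' : #|T|%:R <= expR ((r + 1) * ln 2) / expR ((r + 1) * ln eps).
  apply: (@le_trans _ _ n%:R); first by rewrite ler_nat.
  apply: le_trans n_le _; rewrite ln_div ?posrE // -expRN -expRD ler_expR.
  lra.
split.
  move=> trans; apply: le_trans (chain_rec_time_le c_diam eps0 trans) _.
  rewrite -EFinD epowE inver gt_eqF ?expR_gt0 // -EFinM lee_fin.
  (* Here [r >= 0] gives [2 ^ (r + 1) <= 2 ^ (2 (r + 1))]. *)
  apply: le_trans T_le' _; rewrite ler_pM2r ?invr_gt0 ?expR_gt0 // ler_expR.
  by rewrite ler_pM2r ?ln_gt0 ?ltr1n //; lra.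
move=> mix delta eps_delta.
apply: le_trans (chain_mix_time_le c_diam c_surj m_ge1 eps0 eps_delta mix) _.
rewrite -EFinD -EFinM epowE inver gt_eqF ?expR_gt0 // -EFinM lee_fin natrX.
apply: le_trans (lerXn2r 2 _ _ T_le') _; rewrite ?nnegrE ?divr_ge0 ?expR_ge0 //.
by rewrite expr_div_n -!expRM_natl !mulrA.
Unshelve. all: by end_near. Qed.
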